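(* Let $S^{(0)}=1$ and, for $i\in\mathbb{N}$, let $S^{(i+1)}=S^{(i)}0^{|S^{(i)}|}S^{(i)}$ (the concatenation of $S^{(i)}$, a block of $|S^{(i)}|$ zeros, and $S^{(i)}$ again). Let $x$ be the Cantor string, i.e. the unique right-infinite binary string having every $S^{(i)}$ as an initial segment. Then $p_x(n)=2n-1$ for all integers $n>1$.
   Context: For a binary string $s$ and a positive integer $n$, $p_s(n)$ denotes the number of distinct (contiguous) substrings of $s$ of length $n$. $0^k$ denotes a string of $k$ zeros and $|w|$ the length of a word $w$. *)

(* Defs.v *)
From mathcomp Require Import all_boot.
From mathcomp Require Import boolp.

Set Implicit Arguments.
Unset Strict Implicit.
Unset Printing Implicit Defensive.

(* Binary letters are booleans, with [true] for 1 and [false] for 0; finite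
   strings are [seq bool] and right-infinite strings are [nat -> bool]. *)

Definition substring_at (x : nat -> bool) (k n : nat) : n.-tuple bool :=
  [tuple x (k + i) | i < n].

Definition is_substring (x : nat -> bool) (n : nat) (w : n.-tuple bool) : Prop :=
  exists k : nat, w = substring_at x k n.

Definition subword_complexity (x : nat -> bool) (n : nat) : nat :=
  #|[set w : n.-tuple bool | `[< is_substring x w >]]|.

Definition initial_segment (w : seq bool) (x : nat -> bool) : Prop :=
  mkseq x (size w) = w.

Fixpoint S_ (i : nat) : seq bool :=
  if i is j.+1 then S_ j ++ nseq (size (S_ j)) false ++ S_ j else [:: true].

Definition is_cantor_string (x : nat -> bool) : Prop :=
  forall i : nat, initial_segment (S_ i) x.

Lemma ltn_size_S_ i : i < size (S_ i).
Proof.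
elim: i => //= i IHi; rewrite !size_cat size_nseq.
by rewrite -[i.+2]addn1 leq_add // ltn_addr // (leq_trans _ IHi).
Qed.

Lemma nth_S_ i j k : k < size (S_ i) ->
  nth false (S_ (i + j)) k = nth false (S_ i) k.
Proof.
move=> ltk; elim: j => [|j IHj]; first by rewrite addn0.
rewrite addnS /= nth_cat IHj ifT // (leq_trans ltk) //.
elim: j {IHj} => [|j IHj]; first by rewrite addn0.
by rewrite addnS /= size_cat (leq_trans IHj) // leq_addr.
Qed.

Lemma cantor_string_exists_unique : exists! x : nat -> bool, is_cantor_string x.
Proof.
exists (fun k => nth false (S_ k) k); split=> [i|y Hy].
  apply: (@eq_from_nth _ false); rewrite size_mkseq // => k ltk.
  rewrite nth_mkseq //; have [leik|/ltnW leki] := leqP i k.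
    by rewrite -(subnKC leik) nth_S_ // subnKC.
  by rewrite -[in RHS](subnKC leki) nth_S_ // ltn_size_S_.
apply/funext => k; rewrite -(Hy k) nth_mkseq //; exact: ltn_size_S_.
Qed.

(* Main.v *)
Require Import Defs.
From mathcomp Require Import all_boot.
From mathcomp Require Import boolp zify.

Set Implicit Arguments.
Unset Strict Implicit.
Unset Printing Implicit Defensive.

(** The Cantor string is the fixed point of the substitution 1 -> 101,
    0 -> 000.  A nonzero factor of length m >= 4 determines the residue modulo 3
    of the positions where it occurs, and an occurrence at position 3k + r
    carries the same information as the factor of length (m + r + 2) / 3 at
    position k.  Hence the number q of nonzero factors satisfies
      q(m) = q((m + 2) / 3) + q((m + 3) / 3) + q((m + 4) / 3)   for m >= 4,
    and q(n) = 2n - 2 follows from q(2) = 2 and q(3) = 4; the zero word accounts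
    for one more factor. *)

(** * Comparing sets of values through the positions where they occur *)

Definition occurring (T : finType) (P : pred nat) (f : nat -> T) : {set T} :=
  [set a | `[< exists2 k, P k & a = f k >]].

Lemma occurringP (T : finType) (P : pred nat) (f : nat -> T) a :
  reflect (exists2 k, P k & a = f k) (a \in occurring P f).
Proof. by rewrite inE; apply: asboolP. Qed.

(** Sending each value of [f] to the value of [g] at a chosen position of it is injective, because
    [g k] determines [f k]. *)
Lemma leq_card_occurring (A B : finType) (P : pred nat) (f : nat -> A)
    (g : nat -> B) :
  (forall k l, g k = g l -> f k = f l) ->
  #|occurring P f| <= #|occurring P g|.
Proof.
move=> gf.
(* [g 0] is a dummy, taken only outside [occurring P f]. *)
pose h a := if pselect (exists2 k, P k & a = f k) is left e
            then g (s2val (cid2 e)) else g 0.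
have hP a : a \in occurring P f -> exists k, [/\ P k, a = f k & h a = g k].
  move=> /occurringP aP; rewrite /h; case: pselect => // e.
  by case: (cid2 e) => k /= Pk ak; exists k.
rewrite -(card_in_imset (f := h)) => [|a b /hP[k [_ -> ->]] /hP[l [_ -> ->]]];
  last exact: gf.
apply/subset_leq_card/subsetP => _ /imsetP[a /hP[k [Pk _ ->]] ->].
by apply/occurringP; exists k.
Qed.

Lemma eq_card_occurring (A B : finType) (P : pred nat) (f : nat -> A)
    (g : nat -> B) :
  (forall k l, f k = f l <-> g k = g l) ->
  #|occurring P f| = #|occurring P g|.
Proof.
by move=> fg; apply/eqP; rewrite eqn_leq !leq_card_occurring // => k l /fg.
Qed.

Lemma substring_atP (x : nat -> bool) k l n :
  substring_at x k n = substring_at x l n <->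
  (forall i, i < n -> x (k + i) = x (l + i)).
Proof.
split=> [e i lt_in|e].
  by have := congr1 (fun t => tnth t (Ordinal lt_in)) e; rewrite !tnth_mktuple.
by apply: eq_from_tnth => i; rewrite !tnth_mktuple e.
Qed.

Lemma mem_substring_at (x : nat -> bool) k n :
  reflect (exists2 i, i < n & x (k + i)) (true \in substring_at x k n).
Proof.
apply: (iffP (tnthP _ _)) => [[i]|[i lt_in xi]].
  by rewrite tnth_mktuple => xi; exists i.
by exists (Ordinal lt_in); rewrite tnth_mktuple.
Qed.

Lemma substring_atE (x : nat -> bool) k n :
  substring_at x k n = map x (iota k n) :> seq bool.
Proof.
apply: (@eq_from_nth _ false) => [|i]; rewrite size_tuple ?size_map ?size_iota //.
move=> lt_in; rewrite (nth_map 0) ?size_iota // nth_iota //.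
by rewrite -(tnth_nth false _ (Ordinal lt_in)) tnth_mktuple.
Qed.

Definition nonzero_factors (x : nat -> bool) n : {set n.-tuple bool} :=
  occurring (fun k => true \in substring_at x k n) (substring_at x ^~ n).

(** * Factors of a fixed point of the substitution *)

Section SubstitutionFixedPoint.

Variable x : nat -> bool.
Hypothesis xE : forall k, x k = (k %% 3 != 1) && x (k %/ 3).

(** The middle letter of a block is 0, so two adjacent ones would have to straddle a block boundary;
    they would then come from two adjacent ones at [k %/ 3], and descent applies. *)
Lemma cantor_no_11 k : ~~ (x k && x k.+1).
Proof.
elim/ltn_ind: k => k IHk.
have [k3|k3] := eqVneq (k %% 3) 2; last first.
  rewrite [x k]xE [x k.+1]xE.
  have [->//|->] : k %% 3 = 1 \/ k.+1 %% 3 = 1 by lia.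
  by rewrite andbF.
rewrite [x k]xE [x k.+1]xE.
have -> : k.+1 %/ 3 = (k %/ 3).+1 by lia.
have := IHk (k %/ 3) ltac:(lia).
by do 2!case: (x _); rewrite ?andbF.
Qed.

(** A 1 stands at residue 0 or 2. If the two copies of the same 1 disagree, say residue 2 at [a + i]
    and 0 at [b + i], then two places to the right, [a] sees a middle 0 and [b] the closing 1 of its
    block; two places to the left, [a] sees the opening 1 and [b] a middle 0. As [3 < m], one of
    these places is inside the window. *)
Lemma occurrence_residue m a b i : 3 < m -> i < m ->
    (forall j, j < m -> x (a + j) = x (b + j)) -> x (a + i) ->
  a %% 3 = b %% 3.
Proof.
move=> m3; wlog leab : a b / (b + i) %% 3 <= (a + i) %% 3.
  move=> W im e xai; have [le|/ltnW le] := leqP ((b + i) %% 3) ((a + i) %% 3).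
    exact: W.
  by symmetry; apply: W => // [j jm|]; rewrite -e.
move=> im e xai; apply/eqP/negPn/negP => /eqP ne.
have xbi : x (b + i) by rewrite -e.
have [a1 a2] : (a + i) %% 3 != 1 /\ x ((a + i) %/ 3).
  by apply/andP; rewrite -xE.
have [b1 b2] : (b + i) %% 3 != 1 /\ x ((b + i) %/ 3).
  by apply/andP; rewrite -xE.
have [im2|im2] := ltnP (i + 2) m.
  have := e _ im2; rewrite xE [RHS]xE.
  have -> : (a + (i + 2)) %% 3 = 1 by lia.
  have -> : (b + (i + 2)) %% 3 = 2 by lia.
  by have -> : (b + (i + 2)) %/ 3 = (b + i) %/ 3; [lia | rewrite b2].
have := e (i - 2) ltac:(lia); rewrite xE [RHS]xE.
have -> : (a + (i - 2)) %% 3 = 0 by lia.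
have -> : (b + (i - 2)) %% 3 = 1 by lia.
by have -> : (a + (i - 2)) %/ 3 = (a + i) %/ 3; [lia | rewrite a2].
Qed.

Section Desubstitution.

Variables (m r : nat).
Hypotheses (m1 : 1 < m) (r3 : r < 3).

(** A window of length [m] at offset [r] meets the ceiling of [(m + r) / 3] blocks, and shows an
    outer letter of each: the first letter of the block or, if the window starts after it, the
    last. *)
Let window_cover j : j < (m + r + 2) %/ 3 -> exists i,
  [/\ i < m, (r + i) %% 3 != 1 & (r + i) %/ 3 = j].
Proof.
move=> jN; have [r0|r0] := ltnP (3 * j) r.
  by exists (2 - r); split; lia.
by exists (3 * j - r); split; lia.
Qed.

Let cantor_window k i :
  x (3 * k + r + i) = ((r + i) %% 3 != 1) && x (k + (r + i) %/ 3).
Proof. by rewrite xE; congr ((_ != _) && x _); lia. Qed.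

Lemma eq_substring_desubst k l :
  substring_at x (3 * k + r) m = substring_at x (3 * l + r) m <->
  substring_at x k ((m + r + 2) %/ 3) = substring_at x l ((m + r + 2) %/ 3).
Proof.
rewrite !substring_atP; split=> e i lti.
  have [j [jm j1 <-]] := window_cover lti.
  by have := e _ jm; rewrite !cantor_window j1.
rewrite !cantor_window; case: eqVneq => //= i1.
by apply: e; lia.
Qed.

Lemma nonzero_substring_desubst k :
  (true \in substring_at x (3 * k + r) m) =
  (true \in substring_at x k ((m + r + 2) %/ 3)).
Proof.
apply/mem_substring_at/mem_substring_at => -[i lti].
  rewrite cantor_window => /andP[i1 xi].
  by exists ((r + i) %/ 3) => //; lia.
have [j [jm j1 <-]] := window_cover lti.
by move=> xi; exists j => //; rewrite cantor_window j1.
Qed.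

End Desubstitution.

(** Nonzero factors are sorted by the residue of their positions, and each class is counted by
    desubstitution. *)
Lemma card_nonzero_factors_rec m : 3 < m ->
  #|nonzero_factors x m| =
  \sum_(r < 3) #|nonzero_factors x ((m + r + 2) %/ 3)|.
Proof.
move=> m3.
pose F (r : 'I_3) := occurring
  (fun k => true \in substring_at x (3 * k + r) m)
  (fun k => substring_at x (3 * k + r) m).
have cardF r : #|F r| = #|nonzero_factors x ((m + r + 2) %/ 3)|.
  rewrite /F; under [X in occurring X]funext => k do
    rewrite nonzero_substring_desubst ?(ltnW (ltnW m3)) //.
  apply: eq_card_occurring => k l.
  by apply: eq_substring_desubst; rewrite ?(ltnW (ltnW m3)).
have -> : nonzero_factors x m = \bigcup_r F r.
  apply/setP => w; apply/occurringP/bigcupP => [[k kP ->]|[r _]].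
    have k3 : k %% 3 < 3 by rewrite ltn_mod.
    exists (Ordinal k3) => //; apply/occurringP; exists (k %/ 3) => /=;
      by rewrite mulnC -divn_eq.
  by case/occurringP=> k kP ->; exists (3 * k + r).
rewrite -sum1_card partition_disjoint_bigcup => [|r s ne].
  by apply: eq_bigr => r _; rewrite sum1_card cardF.
(* A common word would be nonzero and occur at both residues [r] and [s]. *)
rewrite -setI_eq0; apply/eqP/setP => w; rewrite [RHS]inE; apply/negP.
case/setIP=> /occurringP[k kP ->] /occurringP[l _] /substring_atP e.
have /mem_substring_at[i im xi] := kP.
have := occurrence_residue m3 im e xi.
have := ltn_ord r; have := ltn_ord s; move/eqP: ne => ne ? ? ?.
by apply: ne; apply: val_inj => /=; lia.
Qed.

(** * Initial values and solution of the recurrence *)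

Hypothesis x0 : x 0.

Let cantor_prefix :
  [/\ ~~ x 1, x 2, ~~ x 3 & ~~ x 4] /\ ~~ x 5 /\ x 6.
Proof.
have x1 : ~~ x 1 by rewrite xE.
have x2 : x 2 by rewrite xE.
by split; split=> //; rewrite xE.
Qed.

Lemma card_nonzero_factors2 : #|nonzero_factors x 2| = 2.
Proof.
have [[x1 x2 _ _] _] := cantor_prefix.
suff -> : nonzero_factors x 2 = [set [tuple true; false]; [tuple false; true]].
  by rewrite cards2.
apply/setP => w; apply/occurringP/idP => [[k]|].
  rewrite memtE substring_atE => + wE.
  rewrite !inE -!val_eqE /= wE substring_atE /=.
  by have := cantor_no_11 k; do 2!case: (x _).
(* The witnesses are read off the prefix 1010001. *)
rewrite !inE => /orP[]/eqP->; [exists 0|exists 1];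
  rewrite ?memtE; try apply: val_inj;
  by rewrite /= substring_atE /= ?x0 ?x2 ?(negbTE x1).
Qed.

Lemma card_nonzero_factors3 : #|nonzero_factors x 3| = 4.
Proof.
have [[x1 x2 x3 x4] [x5 x6]] := cantor_prefix.
pose F : seq (3.-tuple bool) :=
  [:: [tuple true; false; true]; [tuple false; true; false];
      [tuple true; false; false]; [tuple false; false; true]].
suff -> : nonzero_factors x 3 = [set:: F].
  by rewrite cardsE; apply/card_uniqP.
apply/setP => w; apply/occurringP/idP => [[k]|].
  rewrite memtE substring_atE => + wE.
  rewrite !inE -!val_eqE /= wE substring_atE /=.
  by have := cantor_no_11 k; have := cantor_no_11 k.+1; do 3!case: (x _).
rewrite !inE => /or4P[]/eqP->; [exists 0|exists 1|exists 2|exists 4];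
  rewrite ?memtE; try apply: val_inj;
  by rewrite /= substring_atE /= ?x0 ?x2 ?x6 ?(negbTE x1) ?(negbTE x3)
    ?(negbTE x4) ?(negbTE x5).
Qed.

Lemma card_nonzero_factors n : 1 < n -> #|nonzero_factors x n| = 2 * n - 2.
Proof.
elim/ltn_ind: n => n IHn n1.
have [n3|n3] := ltnP 3 n; last first.
  have [->|->] : n = 2 \/ n = 3 by lia.
    exact: card_nonzero_factors2.
  exact: card_nonzero_factors3.
rewrite card_nonzero_factors_rec // !big_ord_recl big_ord0 /= /bump /=.
(* The three lengths lie strictly between 1 and [n] and add up to [n + 2], which gives
   [2 * (n + 2) - 6]. *)
by rewrite !IHn; lia.
Qed.

Lemma subword_complexity_fixed_point n :
    (exists k, forall i, i < n -> ~~ x (k + i)) -> 1 < n ->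
  subword_complexity x n = 2 * n - 1.
Proof.
move=> [z zP] n1; rewrite /subword_complexity.
have -> : [set w : n.-tuple bool | `[< is_substring x w >]] =
    substring_at x z n |: nonzero_factors x n.
  apply/setP => w; rewrite in_setU1 [LHS]inE.
  apply/asboolP/predU1P => [[k ->]|[->|/occurringP[k _ ->]]]; try by eexists.
  have [t|t] := boolP (true \in substring_at x k n).
    by right; apply/occurringP; exists k.
  left; apply/substring_atP => i lt_in; rewrite (negbTE (zP _ lt_in)).
  apply/negbTE/negP => xi; move/negP: t; apply.
  by apply/mem_substring_at; exists i.
rewrite cardsU1 card_nonzero_factors // (_ : _ \notin _); first by lia.
apply/negP => /occurringP[k kP e]; move: kP; rewrite -e.
by case/mem_substring_at => i /zP/negbTE ->.
Qed.

End SubstitutionFixedPoint.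

(** * The Cantor string as a fixed point *)

Definition triple (s : seq bool) : seq bool :=
  flatten [seq [:: b; false; b] | b <- s].

(** The substitution respects concatenation and triples every length, hence also the central block
    of zeros. *)
Lemma S_triple i : S_ i.+1 = triple (S_ i).
Proof.
elim: i => // i IHi.
have tcat s t : triple (s ++ t) = triple s ++ triple t.
  by rewrite /triple map_cat flatten_cat.
have tnseq n : triple (nseq n false) = nseq (3 * n) false.
  by elim: n => // n IHn; rewrite mulnS /= -IHn.
rewrite -[S_ i.+2]/(S_ i.+1 ++ nseq (size (S_ i.+1)) false ++ S_ i.+1).
rewrite {4}[S_ i.+1]/= !tcat tnseq -IHi; congr (_ ++ nseq _ _ ++ _).
by rewrite /= !size_cat size_nseq; lia.
Qed.

Lemma nth_triple s k :
  nth false (triple s) k = (k %% 3 != 1) && nth false s (k %/ 3).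
Proof.
elim: s k => [|b s IHs] k; first by rewrite /= !nth_nil andbF.
case: k => [|[|[|k]]] //; rewrite -[LHS]/(nth false (triple s) k) IHs.
by rewrite -[k.+3]/(3 + k) modnDl divnDl // divnn.
Qed.

Lemma cantor_nth (x : nat -> bool) i k :
  is_cantor_string x -> k < size (S_ i) -> x k = nth false (S_ i) k.
Proof. by move=> /(_ i) {2}<- lt_k; rewrite nth_mkseq. Qed.

Theorem theorem1 (x : nat -> bool) (hx : is_cantor_string x) (n : nat)
  (hn : 1 < n) : subword_complexity x n = 2 * n - 1.
Proof.
apply: subword_complexity_fixed_point => // [k||].
- have lt_k := ltn_size_S_ k.
  (* Position [k] is read in [S_ k.+1], the image of [S_ k], which is long enough to contain
     position [k %/ 3]. *)
  rewrite (cantor_nth (i := k.+1) hx); last by rewrite /= size_cat ltn_addr.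
  rewrite S_triple nth_triple -(cantor_nth (i := k) hx) //.
  exact: leq_ltn_trans (leq_div k 3) lt_k.
- by rewrite (cantor_nth (i := 0) hx).
(* The central zeros of [S_ n.+1] start at [size (S_ n)] and number more than [n]. *)
- exists (size (S_ n)) => i lt_in; have lt_i := ltn_trans lt_in (ltn_size_S_ n).
  rewrite (cantor_nth (i := n.+1) hx) /=; last first.
    by rewrite !size_cat size_nseq; lia.
  by rewrite nth_cat ltnNge leq_addr addKn nth_cat size_nseq lt_i nth_nseq lt_i.
Qed.
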